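(* Let $n\ge 1$. Then $$\sum_{\sigma\in \mathfrak{S}_n}t^{\operatorname{exc} \sigma}q^{\operatorname{inv}\sigma-\operatorname{exc}\sigma}=\sum_{0\leq k\leq (n-1)/2}\gamma_{n,k}(q)\, t^k(1+t)^{n-1-2k},$$ where $$\gamma_{n,k}(q)=\sum_{\sigma\in \mathrm{DD}_{n,k}} q^{2\operatorname{res} \sigma+\operatorname{les} \sigma}.$$ Moreover, for every $0\leq k\leq (n-1)/2$, the polynomial $\gamma_{n,k}(q)$ is divisible by $q^k(1+q)^k$.
   Context: $\mathfrak{S}_n$ is the set of permutations of $[n]=\{1,\dots,n\}$, written as words $\sigma=\sigma(1)\cdots\sigma(n)$. An index $i\in[n]$ is an excedance of $\sigma$ if $i<\sigma(i)$; $\operatorname{exc}\sigma$ is the number of excedances. $\operatorname{inv}\sigma$ is the number of pairs $(i,j)$ with $i<j$ and $\sigma(i)>\sigma(j)$. An index $i<n$ is a descent if $\sigma(i)>\sigma(i+1)$; $\operatorname{des}\sigma$ is the number of descents. For the word $\sigma(1)\cdots\sigma(n)0$ (i.e. setting $\sigma(n+1)=0$), $\operatorname{dd}(\sigma 0)$ is the number of indices $i$ with $1<i\le n$ and $\sigma(i-1)>\sigma(i)>\sigma(i+1)$. Define $\mathrm{DD}_{n,k}=\{\sigma\in\mathfrak{S}_n:\operatorname{des}\sigma=k,\ \operatorname{dd}(\sigma 0)=0\}$. The statistic $\operatorname{les}\sigma$ is the number of pairs $(i,j)$ with $2\le i<j\le n$ and $\sigma(i-1)>\sigma(j)>\sigma(i)$;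 the statistic $\operatorname{res}\sigma$ is the number of pairs $(i,j)$ with $1\le i<j\le n-1$ and $\sigma(j+1)>\sigma(i)>\sigma(j)$. *)

(* Defs.v *)
From mathcomp Require Import all_boot all_order all_algebra all_fingroup.
Set Implicit Arguments.
Unset Strict Implicit.
Unset Printing Implicit Defensive.
Import GRing.Theory.

(* Permutations of [n] are represented by s : 'S_n, acting on {0, ..., n-1}.
   [wd s] is the 1-based word of s: wd s i is the i-th letter, in {1, ..., n},
   for 1 <= i <= n, and it is 0 elsewhere; in particular wd s n.+1 = 0. *)
Definition wd (n : nat) (s : 'S_n) (i : nat) : nat :=
  if i is j.+1 then oapp (fun x : 'I_n => (s x).+1) 0 (insub j) else 0.

(* exc and inv only compare indices and letters, so the shift by 1 between
   'I_n and [n] is immaterial. *)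
Definition exc_stat (n : nat) (s : 'S_n) : nat := #|[set i : 'I_n | i < s i]|.

Definition inv_stat (n : nat) (s : 'S_n) : nat :=
  #|[set p : 'I_n * 'I_n | (p.1 < p.2) && (s p.1 > s p.2)]|.

(* In the next statistics the indices are 1-based; 'I_n.+1 only serves as a
   finite index type, the actual bounds are explicit. *)
Definition des_stat (n : nat) (s : 'S_n) : nat :=
  #|[set i : 'I_n.+1 | (1 <= i < n) && (wd s i > wd s i.+1)]|.

Definition dd0_stat (n : nat) (s : 'S_n) : nat :=
  #|[set i : 'I_n.+1 | (1 < i <= n) && (wd s i.+1 < wd s i < wd s i.-1)]|.

Definition les_stat (n : nat) (s : 'S_n) : nat :=
  #|[set p : 'I_n.+1 * 'I_n.+1 |
      [&& 2 <= p.1, p.1 < p.2, p.2 <= n & wd s p.1 < wd s p.2 < wd s p.1.-1]]|.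

Definition res_stat (n : nat) (s : 'S_n) : nat :=
  #|[set p : 'I_n.+1 * 'I_n.+1 |
      [&& 1 <= p.1, p.1 < p.2, p.2 <= n.-1 & wd s p.2 < wd s p.1 < wd s p.2.+1]]|.

Definition DD (n k : nat) : {set 'S_n} :=
  [set s : 'S_n | (des_stat s == k) && (dd0_stat s == 0)].

Definition gamma (n k : nat) : {poly int} :=
  (\sum_(s in DD n k) 'X^(2 * res_stat s + les_stat s))%R.

Lemma wdE (n : nat) (s : 'S_n) (i : 'I_n) : wd s i.+1 = (s i).+1.
Proof. by rewrite /wd valK. Qed.

Lemma wd_last (n : nat) (s : 'S_n) : wd s n.+1 = 0.
Proof. by rewrite /wd insubF ?ltnn. Qed.

(* This makes the truncated subtraction inv_stat s - exc_stat s a true one. *)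
Lemma exc_le_inv (n : nat) (s : 'S_n) : exc_stat s <= inv_stat s.
Proof.
have ex_inv (i : 'I_n) : i < s i -> exists j : 'I_n, (i < j) && (s j < s i).
  move=> lt_i; apply/existsP; apply: contraTT lt_i => /existsPn noj.
  rewrite -leqNgt.
  have card_lt (m : 'I_n) : #|[set j : 'I_n | j < m]| = m.
    by rewrite -sum1dep_card (big_ord_narrow (ltnW (ltn_ord m))) sum1_card card_ord.
  rewrite -[X in X <= _]card_lt -[X in _ <= X]card_lt.
  rewrite -[X in X <= _](card_imset _ (@perm_inj _ (s^-1)%g)).
  apply/subset_leq_card/subsetP => x /imsetP[y]; rewrite inE => lt_y ->.
  rewrite inE ltn_neqAle leqNgt; apply/andP; split.
    apply: contraTneq lt_y => /ord_inj e.
    by rewrite -{1}(permKV s y) e ltnn.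
  by apply: contra (noj ((s^-1)%g y)) => ->; rewrite permKV.
pose f (i : 'I_n) := (i, odflt i [pick j : 'I_n | (i < j) && (s j < s i)]).
have f_inj : injective f by move=> i j [].
rewrite /exc_stat -(card_imset _ f_inj).
apply/subset_leq_card/subsetP => p /imsetP[i]; rewrite inE => lt_i ->.
rewrite inE /f /=; case: pickP => //= none.
by have [j] := ex_inv i lt_i; rewrite none.
Qed.

(* Main.v *)
Require Import Defs.
From mathcomp Require Import all_boot all_order all_algebra all_fingroup.
From mathcomp Require Import zify ring.
Set Implicit Arguments.
Unset Strict Implicit.
Unset Printing Implicit Defensive.
Import GRing.Theory.

(** Both sides are the same sum over weighted Motzkin paths.  Put
    [c_h = q^h [h+1]_q].

    Excedances: let [W_n(a,b)] be the sum of [t^exc q^(inv-exc)] over the [s] in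
    [S_n] sending the first [a] positions to values [>= b].  Deleting one entry of
    the permutation matrix gives
    [W_n(h+1,h+1) = W_n(h+1,h+2) + t c_h W_(n-1)(h,h+1)] and
    [W_n(h,h+1) = W_n(h+1,h+1) + c_h W_(n-1)(h,h)], that is, weighted Dyck paths
    of length [2n]; pairing up their steps gives Motzkin paths with level weights
    [(1+t) c_h] and up-down weights [t c_h c_(h+1)].

    Descents: build the word of [s] by inserting its letters in increasing order,
    recording only where holes (nonempty runs of larger letters) remain.  Each
    letter is put in one of the [h+1] current holes, and [les] and [res] count the
    holes to its left and to its right, so it contributes [c_h]; it is a valley,
    a peak or a double ascent according to whether it splits, fills or shortens
    the hole.

    Divisibility holds because every product [c_h c_(h+1)] is divisible by
    [q (1+q)]. *)

(** * Excedances and inversions *)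

Lemma lift_perm_onto (n : nat) (i j : 'I_n.+1) (s : 'S_n.+1) :
  s i = j -> exists s', s = lift_perm i j s'.
Proof.
move=> sij; pose f k := odflt k (unlift j (s (lift i k))).
have fE k : lift j (f k) = s (lift i k).
  rewrite /f; case: unliftP => [m -> //|] /= e.
  have := neq_lift i k; rewrite -(inj_eq (@perm_inj _ s)) sij -e.
  by rewrite eqxx.
have f_inj : injective f.
  by move=> k l e; apply/(@lift_inj _ i)/(@perm_inj _ s); rewrite -!fE e.
exists (perm f_inj); apply/permP => k.
case: (unliftP i k) => [k'|] ->; last by rewrite lift_perm_id.
by rewrite lift_perm_lift permE fE.
Qed.

Lemma lift_perm_inj (n : nat) (i j : 'I_n.+1) : injective (@lift_perm n i j).
Proof.
move=> s s' e; apply/permP => k; apply: (@lift_inj _ j).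
by rewrite -!(lift_perm_lift i) e.
Qed.

Lemma big_lift_perm (R : nmodType) (n : nat) (i j : 'I_n.+1) (P : pred 'S_n.+1)
    (F : 'S_n.+1 -> R) :
  (\sum_(s | P s && (s i == j)) F s
   = \sum_(s | P (lift_perm i j s)) F (lift_perm i j s))%R.
Proof.
transitivity (\sum_(s in [set s | P (lift_perm i j s)]) F (lift_perm i j s))%R; last first.
  by apply: eq_bigl => s; rewrite inE.
rewrite -(big_imset F (in2W (@lift_perm_inj n i j))).
apply: eq_bigl => s; apply/andP/imsetP => [[Ps /eqP/lift_perm_onto[s' e]]|].
  by exists s'; rewrite ?inE -?e.
by case=> s' + ->; rewrite inE lift_perm_id eqxx.
Qed.

Lemma card_ord_lt (n m : nat) : m <= n -> #|[set k : 'I_n | k < m]| = m.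
Proof.
by move=> le_mn; rewrite -sum1dep_card (big_ord_narrow le_mn) sum1_card card_ord.
Qed.

Lemma card_perm_lt (n m : nat) (s : 'S_n) :
  m <= n -> #|[set k : 'I_n | s k < m]| = m.
Proof.
move=> /card_ord_lt {2}<-; rewrite -(card_imset _ (@perm_inj _ s)).
apply: eq_card => k; rewrite inE; apply/imsetP/idP => [[l]|lt_k].
  by rewrite inE => ? ->.
by exists ((s^-1)%g k); rewrite ?inE permKV.
Qed.

(** The permutation matrix vanishes on the corner rectangle formed by the first [a] positions and
    the [b] smallest values. *)
Definition stair (n a b : nat) (s : 'S_n) : bool :=
  [forall i : 'I_n, (i < a) ==> (b <= s i)].

Section Lift.
Variables (n a b : nat) (i j : 'I_n.+1) (s : 'S_n).
Hypotheses (le_ab : a <= b) (le_ba : b <= a.+1) (le_ia : i <= a) (le_jb : j <= b).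
Hypothesis s_stair : stair a b s.

Let stairP (k : 'I_n) : k < a -> b <= s k.
Proof. by move: s_stair => /forallP/(_ k)/implyP. Qed.

(** If only the value of an old entry shifts, then [k < a <= b <= s k], an excedance before and
    after. If only its position shifts, then [s k < b] forces [s k <= a <= k], an excedance neither
    before nor after. *)
Lemma exc_lift_perm : exc_stat (lift_perm i j s) = (i < j) + exc_stat s.
Proof.
rewrite /exc_stat -!sum1dep_card !big_mkcond /= (bigD1_ord i) //= lift_perm_id.
rewrite [in RHS]big_mkcond /=; congr (_ + _).
apply: eq_bigr => k _; rewrite lift_perm_lift /= /bump.
congr (if _ then _ else _).
by have := @stairP k; case: (leqP i k); case: (leqP j (s k)); lia.
Qed.

(** The [i] positions before the new entry carry values [>= b >= j], and the [j] values below it sit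
    at positions [>= a >= i]; each of these entries makes one inversion with the new one. *)
Lemma inv_lift_perm : inv_stat (lift_perm i j s) = i + j + inv_stat s.
Proof.
pose T n (s : 'S_n) (x y : 'I_n) := nat_of_bool ((x < y) && (s y < s x)).
have invE m (u : 'S_m) : inv_stat u = \sum_x \sum_y T m u x y.
  rewrite /inv_stat -sum1dep_card pair_big big_mkcond /=.
  by apply: eq_bigr => -[x y] _ /=; rewrite /T; case: ifP.
rewrite !invE (bigD1_ord i) // (bigD1_ord i) //= {1}/T ltnn add0n addnC.
rewrite (eq_bigr (fun x => T _ (lift_perm i j s) (lift i x) i
    + \sum_y T _ (lift_perm i j s) (lift i x) (lift i y))) => [|x _]; last first.
  by rewrite (bigD1_ord i).
rewrite big_split /= addnAC; congr (_ + _); last first.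
  apply: eq_bigr => x _; apply: eq_bigr => y _; rewrite /T !lift_perm_lift /=.
  by rewrite /bump; congr nat_of_bool; lia.
rewrite (eq_bigr (fun x : 'I_n => nat_of_bool (x < i))) => [|x _]; last first.
  rewrite /T lift_perm_lift lift_perm_id /= /bump.
  by have := @stairP x; lia.
rewrite -[X in X + _]big_mkcond sum1dep_card card_ord_lt -1?ltnS ?ltn_ord //.
congr (_ + _).
rewrite (eq_bigr (fun x : 'I_n => nat_of_bool (s x < j))) => [|x _]; last first.
  rewrite /T lift_perm_lift lift_perm_id /= /bump.
  by have := @stairP x; lia.
by rewrite -big_mkcond sum1dep_card card_perm_lt -1?ltnS ?ltn_ord.
Qed.

End Lift.

Lemma stair_lift_value (n a b : nat) (i j : 'I_n.+1) (s : 'S_n) :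
  i <= a -> j = b :> nat -> stair a.+1 b (lift_perm i j s) = stair a b s.
Proof.
move=> le_ia jb; apply/forallP/forallP => H k.
  have := H (lift i k); rewrite lift_perm_lift /= /bump jb.
  by case: (leqP i k); case: (leqP b (s k)); lia.
case: (unliftP i k) => [k'|] ->; last by rewrite lift_perm_id jb leqnn implybT.
simpl in k'; have := H k'; rewrite lift_perm_lift /= /bump jb.
by case: (leqP i k'); case: (leqP b (s k')); lia.
Qed.

Lemma stair_lift_position (n a b : nat) (i j : 'I_n.+1) (s : 'S_n) :
  i = a :> nat -> j <= b -> stair a b.+1 (lift_perm i j s) = stair a b s.
Proof.
move=> ia le_jb; apply/forallP/forallP => H k.
  have := H (lift i k); rewrite lift_perm_lift /= /bump ia.
  by case: (leqP a k); case: (leqP j (s k)); lia.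
case: (unliftP i k) => [k'|] ->; last by rewrite lift_perm_id ia ltnn.
simpl in k'; have := H k'; rewrite lift_perm_lift /= /bump ia.
by case: (leqP a k'); case: (leqP j (s k')); lia.
Qed.

Section Stairs.
Variables (R : comNzRingType) (q t : R).
Local Open Scope ring_scope.

Definition exc_weight (n : nat) (s : 'S_n) : R :=
  t ^+ exc_stat s * q ^+ (inv_stat s - exc_stat s).

Definition stair_sum (n a b : nat) : R := \sum_(s : 'S_n | stair a b s) exc_weight s.

(* This is [q^h [h+1]_q], where [[h+1]_q = 1 + q + ... + q^h]. *)
Definition hole_weight (h : nat) : R := \sum_(i < h.+1) q ^+ (h + i).

Lemma exc_weight_lift (n a b : nat) (i j : 'I_n.+1) (s : 'S_n) :
  (a <= b <= a.+1)%N -> (i <= a)%N -> (j <= b)%N -> stair a b s ->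
  exc_weight (lift_perm i j s) = t ^+ (i < j)%N * q ^+ (i + j - (i < j)%N) * exc_weight s.
Proof.
move=> /andP[le_ab le_ba] le_ia le_jb s_st.
rewrite /exc_weight (exc_lift_perm le_ab le_ba le_ia le_jb s_st).
rewrite (inv_lift_perm le_ab le_ba le_ia le_jb s_st) mulrACA -!exprD.
by congr (_ * q ^+ _); have := exc_le_inv s; case: ltnP; lia.
Qed.

(** Pigeonhole: the first [a] positions and the positions of the [b] smallest values would be
    disjoint. *)
Lemma stair_sum0 (n a b : nat) :
  (a <= b <= n)%N -> (n < a + b)%N -> stair_sum n a b = 0.
Proof.
move=> /andP[le_ab le_bn] lt_n; rewrite /stair_sum big_pred0 // => s.
apply/negP => /forallP H; suff : (a + b <= n)%N by rewrite leqNgt lt_n.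
rewrite -[X in (X + _ <= _)%N](card_ord_lt (leq_trans le_ab le_bn)).
rewrite -[X in (_ + X <= _)%N](card_perm_lt s le_bn) -cardsUI.
rewrite [X in (_ + X)%N](_ : _ = 0%N) ?addn0; last first.
  by apply/eqP; rewrite cards_eq0; apply/eqP/setP => k; rewrite !inE; have := H k; lia.
by rewrite -[X in (_ <= X)%N](card_ord n) max_card.
Qed.

(** Split by the position of the value [h.+1]. If it is beyond the first [h.+1] positions, the empty
    rectangle grows by one value; at a position [i <= h] it is an excedance, and deleting it gives
    the factor [t q^(h+i)]. *)
Lemma stair_sum_value (n h : nat) : (h < n)%N ->
  stair_sum n.+1 h.+1 h.+1
  = stair_sum n.+1 h.+1 h.+2 + t * hole_weight h * stair_sum n h h.+1.
Proof.
move=> lt_hn; pose j : 'I_n.+1 := inord h.+1.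
have jE : j = h.+1 :> nat by rewrite inordK.
rewrite /stair_sum (bigID (fun s : 'S_n.+1 => (h < (s^-1)%g j)%N)) /=; congr (_ + _).
  apply: eq_bigl => s; apply/andP/forallP => [[/forallP H sj] k|H].
    have := H k; case: (eqVneq (s k) j) => [e|]; last by rewrite -val_eqE /= jE; lia.
    by move: sj; rewrite -e permK; lia.
  split; first by apply/forallP => k; have := H k; lia.
  by have := H ((s^-1)%g j); rewrite permKV jE; lia.
rewrite (partition_big (fun s : 'S_n.+1 => (s^-1)%g j) (fun v => v <= h)%N) /=; last first.
  by move=> s /andP[_]; rewrite -leqNgt.
rewrite (big_ord_narrow_leq (ltnW lt_hn)) /hole_weight -mulrA mulr_suml mulr_sumr.
apply: eq_bigr => v _; set i := widen_ord _ v.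
have le_ih : (i <= h)%N by rewrite -[X in (X <= _)%N]/(v : nat) -ltnS.
rewrite mulrA mulr_sumr.
transitivity (\sum_(s : 'S_n.+1 | stair h.+1 h.+1 s && (s i == j)) exc_weight s).
  apply: eq_bigl => s; rewrite -andbA; congr (_ && _).
  apply/andP/eqP => [[_ /eqP <-]|<-]; first by rewrite permKV.
  by rewrite permK eqxx -leqNgt.
rewrite big_lift_perm; apply: eq_big => [s|s].
  exact: stair_lift_value.
rewrite (stair_lift_value _ le_ih jE) => st.
rewrite (@exc_weight_lift _ h h.+1) ?leqnn ?leqnSn ?jE //.
by rewrite ltnS le_ih /= addnC addSn subn1.
Qed.

Lemma stair_sum_value0 (n : nat) : stair_sum n 0 0 = stair_sum n 0 1.
Proof. by apply: eq_bigl => s; apply/forallP/forallP. Qed.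

(** Split by the value at position [h]. If it exceeds [h], the empty rectangle grows by one
    position; a value [v <= h] is no excedance, and deleting it gives [q^(h+v)]. *)
Lemma stair_sum_position (n h : nat) : (h <= n)%N ->
  stair_sum n.+1 h h.+1 = stair_sum n.+1 h.+1 h.+1 + hole_weight h * stair_sum n h h.
Proof.
move=> le_hn; pose i : 'I_n.+1 := inord h; have iE : i = h :> nat by rewrite inordK.
rewrite /stair_sum (bigID (fun s : 'S_n.+1 => (h < s i)%N)) /=; congr (_ + _).
  apply: eq_bigl => s; apply/andP/forallP => [[/forallP H si] k|H].
    case: (eqVneq k i) => [->|]; first by rewrite si implybT.
    by rewrite -val_eqE /= iE; have := H k; lia.
  split; last by have := H i; rewrite iE; lia.
  by apply/forallP => k; have := H k; lia.
rewrite (partition_big (fun s : 'S_n.+1 => s i) (fun v => v <= h)%N) /=; last first.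
  by move=> s /andP[_]; rewrite -leqNgt.
rewrite (big_ord_narrow_leq le_hn) /hole_weight mulr_suml.
apply: eq_bigr => v _; set j := widen_ord _ v.
have jE : j = v :> nat by [].
have le_jh : (j <= h)%N by rewrite jE -ltnS.
rewrite mulr_sumr big_lift_perm.
apply: eq_big => [s|s].
  by rewrite (stair_lift_position _ iE le_jh) lift_perm_id -leqNgt le_jh andbT.
rewrite (stair_lift_position _ iE le_jh) => /andP[st _].
rewrite (@exc_weight_lift _ h h) ?leqnn ?leqnSn ?iE //.
by rewrite ltnNge le_jh /= mul1r subn0.
Qed.

(* Paths of length [m] starting at [z], where [z] is the number of holes: the
   usual height is [z - 1], and the last step goes from [1] to [0]. *)
Fixpoint motzkin (y : R) (m z : nat) : R :=
  match m, z with
  | 0, 0 => 1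
  | m'.+1, z'.+1 => t * (hole_weight z' * hole_weight z'.+1) * motzkin y m' z'.+2
                    + motzkin y m' z' + y * hole_weight z' * motzkin y m' z'.+1
  | _, _ => 0
  end.

(** The recursion for [stair_sum] weights down steps, whereas [motzkin] weights the matching up
    steps. The product supplies the weights of the [h] down steps whose up steps precede the
    start. *)
Lemma stair_sum_motzkin (m h : nat) :
  stair_sum (m.+1 + h) h h.+1
  = \prod_(i < h) (t * (hole_weight i * hole_weight i.+1)) * motzkin (1 + t) m.+1 h.+1.
Proof.
elim: m h => [|m IH] h.
  case: h => [|h]; last first.
    rewrite stair_sum0 ?addnS ?add0n; try by lia.
    by rewrite /= !(mulr0, addr0).
  rewrite big_ord0 mul1r /stair_sum /= mulr0 mulr0 add0r addr0.
  rewrite (big_pred1 1%g) => [|s]; last first.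
    have -> : s = 1%g by apply/permP => k; rewrite !ord1.
    by rewrite /= eqxx; apply/forallP.
  have e0 : exc_stat (1%g : 'S_1) = 0%N.
    by apply: eq_card0 => k; rewrite inE perm1 ltnn.
  have i0 : inv_stat (1%g : 'S_1) = 0%N.
    by apply: eq_card0 => -[k l]; rewrite inE !perm1 /= !ord1.
  by rewrite /exc_weight e0 i0 mulr1.
rewrite addSn stair_sum_position; last by lia.
rewrite stair_sum_value; last by lia.
have -> : stair_sum (m.+1 + h).+1 h.+1 h.+2 = stair_sum (m.+1 + h.+1) h.+1 h.+2.
  by rewrite addnS.
rewrite IH big_ord_recr /=.
(* At [h = 0] the conditions [(0,0)] and [(0,1)] are both empty, so there is no down step. *)
case: h => [|h].
  by rewrite stair_sum_value0 IH big_ord0 /=; ring.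
rewrite [(m.+1 + h.+1)%N]addnS stair_sum_value; last by lia.
have -> : stair_sum (m.+1 + h).+1 h.+1 h.+2 = stair_sum (m.+1 + h.+1) h.+1 h.+2.
  by rewrite addnS.
rewrite !IH big_ord_recr /=; ring.
Qed.

Lemma sum_exc_motzkin (n : nat) : (0 < n)%N ->
  \sum_(s : 'S_n) exc_weight s = motzkin (1 + t) n 1.
Proof.
case: n => // m _; have := stair_sum_motzkin m 0.
rewrite addn0 big_ord0 mul1r -stair_sum_value0 => <-.
by apply: eq_bigl => s; apply/esym/forallP.
Qed.

End Stairs.

(** * Skeletons of words *)

Section Skeleton.
Variable w : nat -> nat.

(* [segment x i k] is the part of the word [w] at the positions [i, ..., i+k-1]
   where each maximal run of letters [>= x] is collapsed into the symbol [0] (a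
   hole); a run is recorded at its last position, hence the test on [w i.+1]. *)
Definition block (x i : nat) : seq nat :=
  if w i < x then [:: w i] else if w i.+1 < x then [:: 0] else [::].

Definition segment (x i k : nat) : seq nat := flatten [seq block x l | l <- iota i k].

Lemma segmentS x i k : segment x i k.+1 = block x i ++ segment x i.+1 k.
Proof. by []. Qed.

Lemma segmentD x i k l : segment x i (k + l) = segment x i k ++ segment x (i + k) l.
Proof. by rewrite /segment iotaD map_cat flatten_cat. Qed.

Lemma segment1 x i : segment x i 1 = block x i.
Proof. by rewrite /segment /= cats0. Qed.

Lemma segmentSr x i k : segment x i k.+1 = segment x i k ++ block x (i + k).
Proof. by rewrite -addn1 segmentD segment1. Qed.

Lemma mem_segment x i k y : 0 < x -> y \in segment x i k -> y < x.
Proof.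
move=> x_gt0 /flatten_mapP[l _]; rewrite /block.
case: ltnP => [lt_x|_]; first by rewrite inE => /eqP->.
by case: ltnP => // _; rewrite inE => /eqP->.
Qed.

(** A hole is recorded where the word drops below [x]; positive letters cannot be mistaken for the
    symbol [0]. *)
Lemma count_segment x i k : (forall l, i <= l < i + k -> 0 < w l) ->
  count_mem 0 (segment x i k) = \sum_(i <= l < i + k) (w l.+1 < x <= w l).
Proof.
elim: k i => [|k IH] i wpos; first by rewrite addn0 big_geq.
rewrite segmentS count_cat IH => [|l lP]; last by apply: wpos; lia.
rewrite addSnnS [RHS]big_ltn; last by lia.
congr (_ + _); rewrite /block; case: ltnP => _; last by case: (w i.+1 < x).
by rewrite andbF /= eqn0Ngt wpos //; lia.
Qed.

(** Upward and downward crossings of the level [x] alternate. This is needed because holes are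
    recorded at descents while [res_at] counts ascents. *)
Lemma ascents_descents x i k :
  \sum_(i <= l < i + k) (w l.+1 < x <= w l) + (x <= w (i + k))
  = \sum_(i <= l < i + k) (w l < x <= w l.+1) + (x <= w i).
Proof.
elim: k => [|k IH]; first by rewrite addn0 !big_geq.
rewrite addnS !big_nat_recr ?leq_addr //=.
by case: (leqP x (w (i + k))) IH; case: (leqP x (w (i + k).+1)) => /=; lia.
Qed.

(** The default [1] is a nonzero sentinel: an empty segment does not end in a hole. *)
Lemma last_segment x i k : (forall l, i <= l < i + k -> 0 < w l) ->
  last 1 (segment x i k) = 0 -> w (i + k) < x.
Proof.
elim: k => [|k IH] wpos //; rewrite segmentSr last_cat /block addnS.
 case: ltnP => [_ /= e|le_x]; first by have := wpos (i + k); lia.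
case: ltnP => //= _ /IH; rewrite ltnNge le_x => H.
by apply: H => l lP; apply: wpos; lia.
Qed.

Lemma segment_tail x i k :
  (forall l, i <= l < i + k -> 0 < w l) -> w (i + k) < x ->
  exists2 b, segment x i k = nseq (x <= w i) 0 ++ b & head 1 b != 0.
Proof.
elim: k i => [|k IH] i wpos; first by rewrite addn0 => lt_x; exists [::]; rewrite // leqNgt lt_x.
rewrite -addSnnS => /IH[l lP|b eb hb]; first by apply: wpos; lia.
rewrite segmentS eb /block; case: ltnP => [lt_x|le_x] /=.
  by eexists; [reflexivity|rewrite /=; have := wpos i; lia].
by exists b => //; case: ltnP.
Qed.

Lemma eq_segment x i k :
  (forall l, i <= l <= i + k -> w l != x) -> segment x.+1 i k = segment x i k.
Proof.
move=> wx; congr flatten; apply/eq_in_map => l; rewrite mem_iota /block => lP.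
have ltE y : w y != x -> (w y < x.+1) = (w y < x) by lia.
by rewrite !ltE // wx //; lia.
Qed.

Variable n : nat.
Hypotheses (w0 : w 0 = 0) (wSn : w n.+1 = 0).
Hypothesis w_gt0 : forall i, 1 <= i <= n -> 0 < w i.
Hypothesis w_inj : forall i j, 1 <= i <= n -> 1 <= j <= n -> w i = w j -> i = j.

Definition les_at (j : nat) : nat := \sum_(2 <= i < j) (w i < w j < w i.-1).
Definition res_at (j : nat) : nat := \sum_(j.+1 <= i < n) (w i < w j < w i.+1).

(* Passing from threshold [x = w j] to [x + 1] puts the letter [x] in the hole of
   rank [les_at j], leaving a smaller hole on each side where a larger letter
   is adjacent. *)
Lemma segment_step j (x := w j) : 1 <= j <= n ->
  exists a b, [/\ segment x 1 n = a ++ 0 :: b,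
    segment x.+1 1 n = a ++ nseq (x < w j.-1) 0 ++ x :: nseq (x < w j.+1) 0 ++ b,
    count_mem 0 a = les_at j /\ count_mem 0 b = res_at j,
    last 1 a != 0 /\ head 1 b != 0 & x \notin a /\ x \notin b].
Proof.
case: j @x => // j x /andP[_ lt_jn].
have x_gt0 : 0 < x by apply: w_gt0.
have neq_x l : l <= n.+1 -> l != j.+1 -> w l != x.
  move=> le_l; apply: contraNneq => e.
  have [l0|l_gt0] := posnP l; first by move: x_gt0; rewrite -e l0 w0.
  have [ln|lt_l] := eqVneq l n.+1; first by move: x_gt0; rewrite -e ln wSn.
  by apply/eqP/w_inj => //; lia.
have pos1 : forall l, 1 <= l < 1 + j -> 0 < w l by move=> l ?; apply: w_gt0; lia.
have pos2 : forall l, j.+2 <= l < j.+2 + (n - j.+1) -> 0 < w l by move=> l ?; apply: w_gt0; lia.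
have endE : j.+2 + (n - j.+1) = n.+1 by lia.
have [|b eb hb] := @segment_tail x j.+2 (n - j.+1) pos2; first by rewrite endE wSn.
have nE : n = j + (1 + (n - j.+1)) by lia.
have leE : (x <= w j.+2) = (x < w j.+2).
  by rewrite leq_eqVlt eq_sym (negPf (neq_x _ _ _)) //; lia.
exists (segment x 1 j), b; split.
- rewrite {1}nE segmentD segmentD segment1 add1n addn1 eb /block -/x ltnn.
  by case: ltnP.
- rewrite {1}nE segmentD segmentD segment1 add1n addn1.
  rewrite (@eq_segment _ j.+2) ?eb => [|l lP]; last by apply: neq_x; lia.
  rewrite /block -/x ltnSn leE /=.
  (* At threshold [x] a run on the left continues through the letter [x]; at [x.+1] it ends at the
     left neighbour, which now records a hole. *)
  suff -> : segment x.+1 1 j = segment x 1 j ++ nseq (x < w j) 0 by rewrite -catA.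
  case: j @x lt_jn x_gt0 neq_x {pos1 pos2 endE eb hb nE leE} => [|j] x lt_jn x_gt0 neq_x.
    by rewrite w0.
  rewrite !segmentSr eq_segment => [|l lP]; last by apply: neq_x; lia.
  rewrite -catA add1n /block -/x ltnS ltnn leqnn.
  by case: ltngtP (neq_x j.+1 ltac:(lia) ltac:(lia)).
- split.
    rewrite count_segment // /les_at -/x [RHS]big_add1 /= add1n.
    case: j @x lt_jn x_gt0 neq_x {pos1 pos2 endE eb hb nE leE} => [|j] x lt_jn x_gt0 neq_x.
      by rewrite !big_geq.
    rewrite big_nat_recr //= -/x ltnn addn0; apply: eq_big_nat => i iP.
    by rewrite [x <= _]leq_eqVlt eq_sym (negPf (neq_x _ _ _)) //; lia.
  (* The boundary term of [ascents_descents] is the hole adjacent to [x] on the right, which is not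
     part of [b]; the holes in [b] thus match the ascents across [x]. *)
  have := count_segment x pos2; have := ascents_descents x j.+2 (n - j.+1).
  rewrite endE wSn leqNgt x_gt0 addn0 => -> /=; rewrite eb count_cat count_nseq /= mul1n addnC.
  move/addIn => ->; rewrite /res_at -/x.
  case: (ltngtP j.+1 n) lt_jn => // [lt_jn|<-] _; last by rewrite !big_geq.
  rewrite big_nat_recr //= wSn [x <= 0]leqNgt x_gt0 andbF addn0.
  apply: eq_big_nat => i iP.
  by rewrite [x <= _]leq_eqVlt eq_sym (negPf (neq_x _ _ _)) //; lia.
- split=> //; apply/eqP => /(last_segment pos1); rewrite add1n.
  by rewrite ltnn.
split; first by apply/negP => /(mem_segment x_gt0); rewrite ltnn.
apply/negP => xb; have : x \in segment x j.+2 (n - j.+1) by rewrite eb mem_cat xb orbT.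
by move/(mem_segment x_gt0); rewrite ltnn.
Qed.

End Skeleton.

(** * Filling the holes of a skeleton *)

Lemma cat_cons_notin (T : eqType) (x : T) (a b a' b' : seq T) :
  x \notin a -> x \notin a' -> a ++ x :: b = a' ++ x :: b' -> a = a' /\ b = b'.
Proof.
move=> xa xa' e.
have sz : size a = size a'.
  have := congr1 (index x) e; rewrite !index_cat (negPf xa) (negPf xa') /= eqxx.
  by rewrite !addn0.
by move/eqP: e; rewrite eqseq_cat // eqseq_cons => /and3P[/eqP-> _ /eqP->].
Qed.

Lemma cat_nseq0_inj (a a' : seq nat) (l l' : bool) :
  last 1 a != 0 -> last 1 a' != 0 -> a ++ nseq l 0 = a' ++ nseq l' 0 -> a = a' /\ l = l'.
Proof.
move=> la la' e; have := congr1 (last 1) e; rewrite !last_cat; move: e.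
case: l l' => [] [] /= e; rewrite ?(cats1, cats0) in e.
- by case/rcons_inj: e => ->.
- by move=> e0; rewrite -e0 in la'.
- by move=> e0; rewrite e0 in la.
- by move=> _; rewrite e.
Qed.

Lemma nseq0_cat_inj (b b' : seq nat) (r r' : bool) :
  head 1 b != 0 -> head 1 b' != 0 -> nseq r 0 ++ b = nseq r' 0 ++ b' -> b = b' /\ r = r'.
Proof.
case: r r' => [] [] /= hb hb' e; [|by subst b'|by subst b|by subst b'].
by case: e => ->.
Qed.

Fixpoint fill_hole (X : seq nat) (p : nat) (S : seq nat) : seq nat :=
  if S is y :: S' then
    if y != 0 then y :: fill_hole X p S'
    else if p is p'.+1 then y :: fill_hole X p' S' else X ++ S'
  else [::].

Lemma fill_hole_cat (X a b : seq nat) :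
  fill_hole X (count_mem 0 a) (a ++ 0 :: b) = a ++ X ++ b.
Proof. by elim: a => [|y a IH] //=; case: eqP => [->|_] /=; rewrite IH. Qed.

Lemma split_hole (p : nat) (S : seq nat) : p < count_mem 0 S ->
  exists a b, S = a ++ 0 :: b /\ count_mem 0 a = p.
Proof.
elim: S p => [|y S IH] p //=; case: eqP => [->|/eqP/negPf y0] /=; last first.
  by rewrite add0n => /IH[a [b [-> <-]]]; exists (y :: a), b; rewrite /= y0.
case: p => [|p]; first by exists [::], S.
by rewrite ltnS => /IH[a [b [-> <-]]]; exists (0 :: a), b.
Qed.

Lemma cat_hole_inj (a b a' b' : seq nat) : count_mem 0 a = count_mem 0 a' ->
  a ++ 0 :: b = a' ++ 0 :: b' -> a = a' /\ b = b'.
Proof.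
elim: a a' => [|x a IH] [|x' a'] //= e [].
- by move=> ->.
- by move=> e0; move: e; rewrite -e0.
- by move=> e0; move: e; rewrite e0.
by move=> ex; move: e; rewrite ex => /addnI e /(IH _ e)[-> ->].
Qed.

Definition no_adjacent_holes : rel nat := fun x y => (x != 0) || (y != 0).

(** Two maximal runs are separated by a small letter, so holes are never adjacent; the starting
    value [1] permits a hole in first place. *)
Definition is_skeleton (u : nat) (S : seq nat) : bool :=
  path no_adjacent_holes 1 S && perm_eq [seq y <- S | y != 0] (iota 1 u).

Lemma path_hole (a b : seq nat) : path no_adjacent_holes 1 (a ++ 0 :: b) ->
  [/\ path no_adjacent_holes 1 a, last 1 a != 0, head 1 b != 0 &
      forall x, path no_adjacent_holes x b].
Proof.
rewrite cat_path /= {2}/no_adjacent_holes /= orbF => /and3P[-> -> ].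
case: b => //= y b; rewrite {1}/no_adjacent_holes /= => /andP[y0 pb].
by split=> // x; rewrite /no_adjacent_holes y0 orbT.
Qed.

Lemma is_skeleton_notin (u x : nat) (S : seq nat) :
  is_skeleton u S -> u < x -> x \notin S.
Proof.
case/andP=> _ /perm_mem e lt_x; apply/negP => xS.
have := e x; rewrite mem_filter xS mem_iota; case: x lt_x {xS} => //= x; lia.
Qed.

Lemma is_skeleton_fill (u : nat) (a b : seq nat) (l r : bool) :
  is_skeleton u (a ++ 0 :: b) ->
  is_skeleton u.+1 (a ++ (nseq l 0 ++ u.+1 :: nseq r 0) ++ b).
Proof.
case/andP=> /path_hole[pa la hb pb] pe; apply/andP; split.
  rewrite -catA cat_path pa /=.
  by case: l r => [] [] /=; rewrite pb /no_adjacent_holes /= ?la ?orbT.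
have -> : iota 1 u.+1 = iota 1 u ++ [:: u.+1] by rewrite -[in LHS](addn1 u) iotaD add1n.
have -> : [seq y <- a ++ (nseq l 0 ++ u.+1 :: nseq r 0) ++ b | y != 0]
          = [seq y <- a | y != 0] ++ u.+1 :: [seq y <- b | y != 0].
  by rewrite !filter_cat; case: l r => [] [].
rewrite filter_cat /= in pe.
by rewrite (perm_catCA _ [:: u.+1]) perm_sym perm_catC perm_sym /= perm_cons.
Qed.

Lemma count_fill (u : nat) (a b : seq nat) (l r : bool) :
  count_mem 0 (a ++ (nseq l 0 ++ u.+1 :: nseq r 0) ++ b)
  = count_mem 0 a + count_mem 0 b + l + r.
Proof. by rewrite !count_cat /= !count_nseq /=; lia. Qed.

Lemma wd_inj (n : nat) (s : 'S_n) (i j : nat) :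
  1 <= i <= n -> 1 <= j <= n -> wd s i = wd s j -> i = j.
Proof.
case: i j => [|i] [|j] // lt_i lt_j.
rewrite (wdE s (Ordinal lt_i)) (wdE s (Ordinal lt_j)) => -[/ord_inj/perm_inj[->]].
by [].
Qed.

Lemma wd_gt0 (n : nat) (s : 'S_n) (i : nat) : 1 <= i <= n -> 0 < wd s i.
Proof. by case: i => // i lt_i; rewrite (wdE s (Ordinal lt_i)). Qed.

Definition skeleton (n : nat) (s : 'S_n) (x : nat) : seq nat := segment (wd s) x 1 n.

Section SkeletonStep.
Variables (n : nat) (s : 'S_n) (i : 'I_n) (u : nat) (S : seq nat).
Hypotheses (si : s i = u :> nat) (skS : is_skeleton u S).

Let step := @segment_step (wd s) n (erefl 0) (wd_last s) (@wd_gt0 n s) (@wd_inj n s) i.+1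
  (ltn_ord i).

Lemma les_res_skeleton : skeleton s u.+1 = S ->
  les_at (wd s) i.+1 + res_at (wd s) n i.+1 = (count_mem 0 S).-1.
Proof.
have [a [b []]] := step; rewrite wdE si /skeleton => -> _ [<- <-] _ _ <-.
by rewrite count_cat /= addnCA.
Qed.

Lemma skeleton_hole : skeleton s u.+1 = S -> 0 < count_mem 0 S.
Proof.
have [a [b []]] := step; rewrite wdE si /skeleton => -> _ _ _ _ <-.
by rewrite count_cat /= addnCA.
Qed.

(** The insertion is reversible: cut the new skeleton at its only letter [u.+1]. Since no hole ends
    [a] or starts [b], the holes next to the cut reveal [l] and [r], and the holes of [a] give the
    rank [p]. *)
Lemma skeleton_fill (p : nat) (l r : bool) : p < count_mem 0 S ->
  [&& skeleton s u.+1 == S, wd s i.+1 < wd s i == l, wd s i.+1 < wd s i.+2 == r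
    & les_at (wd s) i.+1 == p]
  = (skeleton s u.+2 == fill_hole (nseq l 0 ++ u.+1 :: nseq r 0) p S).
Proof.
move=> /split_hole[a' [b' [eS ep]]].
have [a [b []]] := step; rewrite wdE si /skeleton => -> -> [ea _] [la hb] [xa xb].
rewrite eS -ep fill_hole_cat /= -catA /=.
have [_ la' hb' _] : [/\ _, _, _ & _] := path_hole (proj1 (andP (eq_ind _ (is_skeleton u) skS _ eS))).
have [xa' xb'] : u.+1 \notin a' /\ u.+1 \notin b'.
  have := is_skeleton_notin skS (ltnSn u); rewrite eS mem_cat inE /= !negb_or.
  by case/andP.
apply/and4P/eqP => [[/eqP e /eqP-> /eqP-> /eqP el]|].
  by have [-> ->] := cat_hole_inj (etrans ea el) e.
rewrite !catA => /cat_cons_notin[]; rewrite ?mem_cat ?mem_nseq ?(negPf xa) ?(negPf xa') ?andbF //.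
case/(cat_nseq0_inj la la')=> eaa -> /(nseq0_cat_inj hb hb')[-> ->].
by rewrite -ea eaa !eqxx.
Qed.

End SkeletonStep.

Lemma skeleton_full (n : nat) (s : 'S_n) : skeleton s n.+1 = [seq wd s i | i <- iota 1 n].
Proof.
have e l : block (wd s) n.+1 l = [:: wd s l].
  rewrite /block; suff -> : wd s l < n.+1 by [].
  case: l => //= l; case: insubP => //= i _ _; exact: ltn_ord.
rewrite /skeleton /segment (eq_map e).
by elim: (iota 1 n) => //= l r ->.
Qed.

Lemma skeleton_init (n : nat) (s : 'S_n) : 0 < n -> skeleton s 1 = [:: 0].
Proof.
case: n s => // n s _.
have ltE l : 1 <= l <= n.+1 -> (wd s l < 1) = false by move/(wd_gt0 s); lia.
have e k : k <= n -> segment (wd s) 1 1 k = [::].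
  elim: k => // k IH lt_k; rewrite segmentSr IH ?(ltnW lt_k) // add1n /block.
  by rewrite !ltE //; lia.
by rewrite /skeleton segmentSr e // add1n /block ltE ?ltnSn // wd_last.
Qed.

Lemma word_perm (n : nat) (S : seq nat) : perm_eq S (iota 1 n) ->
  exists s : 'S_n, forall s' : 'S_n, ([seq wd s' i | i <- iota 1 n] == S) = (s' == s).
Proof.
move=> pS; have szS : size S = n by rewrite (perm_size pS) size_iota.
have uS : uniq S by rewrite (perm_uniq pS) iota_uniq.
have memS (i : 'I_n) : 0 < nth 0 S i <= n.
  have : nth 0 S i \in S by rewrite mem_nth // szS.
  by rewrite (perm_mem pS) mem_iota add1n ltnS.
have lt_n (i : 'I_n) : (nth 0 S i).-1 < n by have := memS i; lia.
pose f i := Ordinal (lt_n i).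
have f_inj : injective f.
  move=> i j [] e; apply/ord_inj/eqP; rewrite -(nth_uniq 0 _ _ uS) ?szS //.
  have [/andP[ri _] /andP[rj _]] := (memS i, memS j); by rewrite -(prednK ri) e prednK.
have wE (s' : 'S_n) (i : 'I_n) : nth 0 [seq wd s' i | i <- iota 1 n] i = (s' i).+1.
  by rewrite (nth_map 0) ?size_iota // nth_iota // add1n wdE.
exists (perm f_inj) => s'; apply/eqP/eqP => [e|->].
  apply/permP => i; rewrite permE; apply/ord_inj => /=.
  by rewrite -e wE.
apply: (@eq_from_nth _ 0); rewrite size_map size_iota // => i lt_i.
rewrite (wE _ (Ordinal lt_i)) permE /=.
by have := memS (Ordinal lt_i) => /=; lia.
Qed.

(** * Summing over the words with a given skeleton *)

Section FibreSum.
Variables (R : comNzRingType) (q t y : R).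
Local Open Scope ring_scope.

(* [l] and [r] tell whether the left and right neighbours are larger; double
   descents ([l] without [r]) are discarded. *)
Definition letter_type (l r : bool) : R :=
  if l then (if r then t else 0) else (if r then y else 1).

Definition letter_weight (n : nat) (s : 'S_n) (i : nat) : R :=
  q ^+ (les_at (wd s) i + 2 * res_at (wd s) n i)
  * letter_type (wd s i < wd s i.-1)%N (wd s i < wd s i.+1)%N.

Lemma hole_weight_rev (h : nat) : \sum_(p < h.+1) q ^+ (p + 2 * (h - p)) = hole_weight q h.
Proof.
rewrite /hole_weight (reindex_inj rev_ord_inj); apply: eq_bigr => p _ /=.
by congr (q ^+ _); have := ltn_ord p; lia.
Qed.

(** Induction on the number [m] of letters still to insert. Each letter contributes its own hole
    weight, but [motzkin] charges a down step to its matching up step; the product pays for the down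
    steps that close the holes already open in [S]. *)
Lemma fibre_sum (n m u : nat) (S : seq nat) : (u + m = n)%N -> is_skeleton u S ->
  \sum_(s : 'S_n | skeleton s u.+1 == S) \prod_(i < n | (u <= s i)%N) letter_weight s i.+1
  = \prod_(i < count_mem 0%N S) hole_weight q i * motzkin q t y m (count_mem 0%N S).
Proof.
elim: m u S => [|m IH] u S.
  rewrite addn0 => -> /andP[_].
  have [z0 pe|z_gt0 _] := posnP (count_mem 0%N S); last first.
    rewrite big_pred0 => [|s].
      by case: (count_mem _ _) z_gt0 => // z _; rewrite /= mulr0.
    apply: contraTF z_gt0 => /eqP <-; rewrite skeleton_full -leqNgt leqn0.
    apply/eqP/count_memPn/negP => /mapP[i]; rewrite mem_iota => iP.
    by have := @wd_gt0 n s i; lia.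
  rewrite z0 big_ord0 mulr1.
  have [|s sE] := @word_perm n S.
    rewrite (_ : [seq y <- S | _] = S) // in pe; apply/all_filterP/allP => x xS.
    by have /count_memPn := z0; apply: contraNneq => <-.
  rewrite (big_pred1 s) => [|s']; last by rewrite skeleton_full sE.
  by rewrite big_pred0 // => i; rewrite leqNgt ltn_ord.
move=> un skS; have lt_un : (u < n)%N by lia.
pose j : 'I_n := Ordinal lt_un; pose i (s : 'S_n) := (s^-1)%g j.
have si (s : 'S_n) : s (i s) = u :> nat by rewrite /i permKV.
case ez : (count_mem 0%N S) => [|z].
  rewrite big_pred0 /= ?mulr0 // => s; apply/eqP => /(skeleton_hole (si s)).
  by rewrite ez.
(* Sort by the neighbour comparisons and the hole rank of the letter [u.+1]. On this fibre
   [les_res_skeleton] bounds the rank by [z], so [inord] loses nothing. *)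
pose f (s : 'S_n) : bool * bool * 'I_z.+1 := (wd s (i s).+1 < wd s (i s), wd s (i s).+1 < wd s (i s).+2,
  inord (les_at (wd s) (i s).+1))%N.
rewrite (partition_big f predT) //=.
pose H (lr : bool * bool) (p : 'I_z.+1) := q ^+ (p + 2 * (z - p)) * letter_type lr.1 lr.2
  * (\prod_(k < z + lr.1 + lr.2) hole_weight q k * motzkin q t y m (z + lr.1 + lr.2)).
transitivity (\sum_(c : bool * bool * 'I_z.+1) H c.1 c.2).
  apply: eq_bigr => -[[l r] p] _ /=.
  have lt_p : (p < count_mem 0 S)%N by rewrite ez.
  have [a [b [eS ep]]] := split_hole lt_p.
  have cb : (count_mem 0 b = z - p)%N.
    by move: ez; rewrite eS count_cat /= ep; lia.
  pose S' := fill_hole (nseq l 0%N ++ u.+1 :: nseq r 0%N) p S.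
  have condE (s : 'S_n) : (skeleton s u.+1 == S) && (f s == (l, r, p)) = (skeleton s u.+2 == S').
    rewrite -(skeleton_fill (si s) skS l r lt_p) /f !xpair_eqE -!andbA.
    apply/andb_id2l => /eqP/(les_res_skeleton (si s)); rewrite ez /= => lr.
    congr [&& _, _ & _]; rewrite -val_eqE /= inordK //; lia.
  rewrite (eq_bigl _ _ condE) /H /=.
  have S'E : S' = a ++ (nseq l 0%N ++ u.+1 :: nseq r 0%N) ++ b.
    by rewrite /S' eS -ep fill_hole_cat.
  have cS' : count_mem 0%N S' = (z + l + r)%N.
    by rewrite S'E count_fill ep cb; have := ltn_ord p; lia.
  rewrite -cS' -(IH u.+1); first last.
  - by rewrite S'E; apply: is_skeleton_fill; rewrite -eS.
  - by rewrite addSnnS.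
  rewrite mulr_sumr; apply: eq_bigr => s.
  rewrite -condE => /andP[/eqP sS /eqP[el er ep']].
  have lesp : les_at (wd s) (i s).+1 = p.
    by rewrite -ep' inordK //; have := les_res_skeleton (si s) sS; rewrite ez; lia.
  rewrite (bigD1 (i s)) /=; last by rewrite si.
  congr (_ * _).
    have := les_res_skeleton (si s) sS; rewrite ez lesp /letter_weight /= el er lesp => e.
    by congr (q ^+ _ * _); lia.
  apply: eq_bigl => k; rewrite -(inj_eq (@perm_inj _ s)) -val_eqE /= si.
  by rewrite ltn_neqAle andbC eq_sym.
rewrite -(pair_bigA _ H) -(pair_bigA _ (fun l r => \sum_p H (l, r) p)) /=.
rewrite !big_bool /= /H /=.
(* For each type, summing over the rank gives [hole_weight q z]; valleys, double ascents and peaks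
   leave [z.+2], [z.+1] and [z] holes. *)
rewrite -!mulr_suml !hole_weight_rev /letter_type !addn0 !addn1.
rewrite !big_ord_recr /=; ring.
Qed.

End FibreSum.

(** * Descents and double descents *)

Arguments wd : simpl never.

Lemma sum_ord_range (N a b : nat) (C : pred nat) : b <= N ->
  \sum_(i < N) ((a <= i < b) && C i) = \sum_(a <= i < b) C i.
Proof.
move=> le_bN; rewrite (big_nat_widen _ _ N) // (big_nat_widenl a 0) // big_mkord.
rewrite [RHS]big_mkcond /=; apply: eq_bigr => i _ /=.
by case: (a <= i); case: (i < b); case: (C i).
Qed.

Lemma les_statE (n : nat) (s : 'S_n) : les_stat s = \sum_(j < n) les_at (wd s) j.+1.
Proof.
rewrite /les_stat -sum1dep_card big_mkcond /=.
rewrite -(pair_bigA _ (fun i j : 'I_n.+1 => if [&& 2 <= i, i < j, j <= n &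
  wd s i < wd s j < wd s i.-1] then 1 else 0)) /= exchange_big /= big_ord_recl /=.
rewrite big1 => [|i _]; last by rewrite andbF.
rewrite add0n; apply: eq_bigr => j _ /=; rewrite /bump leq0n add1n /les_at.
rewrite -(@sum_ord_range n.+1); last exact/leqW/ltn_ord.
apply: eq_bigr => i _; rewrite ltn_ord /= -andbA.
by case: ifP.
Qed.

Lemma res_statE (n : nat) (s : 'S_n) : res_stat s = \sum_(j < n) res_at (wd s) n j.+1.
Proof.
rewrite /res_stat -sum1dep_card big_mkcond /=.
rewrite -(pair_bigA _ (fun i j : 'I_n.+1 => if [&& 1 <= i, i < j, j <= n.-1 &
  wd s j < wd s i < wd s j.+1] then 1 else 0)) /= big_ord_recl /=.
rewrite big1 // add0n; apply: eq_bigr => i _ /=; rewrite /bump leq0n add1n /res_at.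
rewrite -(@sum_ord_range n.+1) //; apply: eq_bigr => j _ /=.
have -> : (j <= n.-1) = (j < n) by have := ltn_ord i; lia.
by rewrite andbA; case: ifP.
Qed.

Section Letters.
Variables (n : nat) (s : 'S_n).

(** Each descent is charged to its lower letter; the added term [i = 0] vanishes because
    [wd s 0 = 0]. *)
Lemma des_statE : des_stat s = \sum_(i < n) (wd s i.+1 < wd s i).
Proof.
rewrite /des_stat -sum1dep_card big_mkcond /=.
transitivity (\sum_(i < n.+1) ((1 <= i < n) && (wd s i.+1 < wd s i))).
  by apply: eq_bigr => i _; case: ifP.
rewrite (@sum_ord_range n.+1 1 n (fun i => wd s i.+1 < wd s i)) //.
have [n0|n_gt0] := posnP n.
  by rewrite big_geq ?n0 // big1 // => i; have := ltn_ord i; lia.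
by rewrite -(big_mkord xpredT (fun i => nat_of_bool (wd s i.+1 < wd s i))) [RHS]big_ltn.
Qed.

Lemma asc_des : \sum_(i < n) (wd s i.+1 < wd s i.+2) = n.-1 - des_stat s.
Proof.
rewrite des_statE.
have [n0|n_gt0] := posnP n.
  have sum0 (F : 'I_n -> nat) : \sum_i F i = 0.
    by apply: big1 => i; have := ltn_ord i; lia.
  by rewrite !sum0 n0.
rewrite -(big_mkord xpredT (fun i => nat_of_bool (wd s i.+1 < wd s i))) [in RHS]big_ltn //= add0n.
rewrite -(big_mkord xpredT (fun i => nat_of_bool (wd s i.+1 < wd s i.+2))).
case: n s n_gt0 => // m u _; rewrite big_nat_recr //= wd_last ltn0 addn0 big_add1 /=.
suff : \sum_(0 <= i < m) (wd u i.+1 < wd u i.+2)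
       + \sum_(0 <= i < m) (wd u i.+2 < wd u i.+1) = m by lia.
rewrite -big_split /= (eq_big_nat _ _ (F2 := fun=> 1)) => [|i iP].
  by rewrite sum_nat_const_nat subn0 muln1.
by case: ltngtP => // /wd_inj e; have := e; lia.
Qed.

Lemma dd0_statP :
  reflect (forall i : 'I_n, wd s i.+1 < wd s i -> wd s i.+1 < wd s i.+2)
          (dd0_stat s == 0).
Proof.
rewrite cards_eq0; apply: (iffP eqP) => [e i lt_i|H]; last first.
  apply/setP => -[i lt_i]; rewrite !inE /=; apply/negP => /and3P[iP].
  case: i lt_i iP => // i lt_i iP; have := H (Ordinal (lt_i : i < n)) => /= {}H.
  by move=> gt /H; lia.
have := in_set0 (inord i.+1 : 'I_n.+1); rewrite -e inE inordK ?ltnS //= lt_i andbT.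
have i_gt0 : 0 < i by case: (nat_of_ord i) lt_i.
rewrite i_gt0 ltn_ord /=; case: ltngtP => // e2 _.
have := @wd_gt0 n s i.+1 (ltn_ord i); have [e1|ne] := eqVneq i.+1 n.
  by have := wd_last s; rewrite -{2}e1; lia.
by have := @wd_inj n s i.+1 i.+2; have := ltn_ord i; lia.
Qed.

End Letters.

Section GammaSum.
Variables (R : comNzRingType) (q t y : R).
Local Open Scope ring_scope.

(** Each descent bottom is followed by an ascent, so there are at least as many ascents as
    descents. *)
Lemma des_le (n : nat) (s : 'S_n) : dd0_stat s == 0%N -> (2 * des_stat s <= n.-1)%N.
Proof.
move/dd0_statP => H.
suff : (des_stat s <= n.-1 - des_stat s)%N by have := leq_subr; lia.
rewrite -asc_des {1}des_statE; apply: leq_sum => i _.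
by have := H i; case: ltnP => // _ ->.
Qed.

(** A double descent makes a factor vanish. Otherwise the valleys are the descent bottoms, and the
    double ascents number ascents minus descents. *)
Lemma prod_letter_weight (n : nat) (s : 'S_n) :
  \prod_(i < n) letter_weight q t y s i.+1
  = if dd0_stat s == 0%N then
      q ^+ (2 * res_stat s + les_stat s) * t ^+ des_stat s * y ^+ (n.-1 - 2 * des_stat s)
    else 0.
Proof.
case: ifP => [/dd0_statP H|/dd0_statP H]; last first.
  have /existsP[i] : [exists i : 'I_n, (wd s i.+1 < wd s i)%N && ~~ (wd s i.+1 < wd s i.+2)%N].
    apply: contra_notT H => /existsPn N i lt_i.
    by have := N i; rewrite lt_i negbK.
  case/andP=> l r; rewrite (bigD1 i) //= /letter_weight /= l (negPf r) /= mulr0.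
  by rewrite mul0r.
rewrite /letter_weight big_split /= -expr_sum big_split /= -big_distrr /=.
rewrite -les_statE -res_statE addnC -mulrA; congr (_ * _).
rewrite mul2n -addnn subnDA -asc_des {2}des_statE -sumnB => [|i _]; last first.
  by have := H i; case: (wd s i.+1 < wd s i)%N => // ->.
rewrite des_statE !expr_sum -big_split /=; apply: eq_bigr => i _.
have := H i; rewrite /letter_type; case: (_ < _)%N => [->//|_] /=.
  by rewrite mulr1.
by case: (_ < _)%N; rewrite mul1r.
Qed.

Lemma gamma_sum (n : nat) : (0 < n)%N ->
  \sum_(s : 'S_n | dd0_stat s == 0%N)
    q ^+ (2 * res_stat s + les_stat s) * t ^+ des_stat s * y ^+ (n.-1 - 2 * des_stat s)
  = motzkin q t y n 1.
Proof.
move=> n_gt0; rewrite big_mkcond /=.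
(* Before any insertion the whole word is a single hole, of weight [1]. *)
have := @fibre_sum _ q t y n n 0 [:: 0%N] (erefl _) isT.
rewrite /= big_ord_recl big_ord0 /hole_weight big_ord_recl big_ord0 !(expr0, addr0, mulr1, mul1r) => <-.
apply: eq_big => [s|s _]; first by rewrite skeleton_init ?eqxx.
by rewrite -prod_letter_weight.
Qed.

End GammaSum.

(** * Divisibility of the coefficients *)

Section Divisibility.
Local Open Scope ring_scope.

Lemma hole_weightE (R : comNzRingType) (q : R) (h : nat) :
  hole_weight q h = q ^+ h * \sum_(i < h.+1) q ^+ i.
Proof. by rewrite /hole_weight mulr_sumr; apply: eq_bigr => i _; rewrite exprD. Qed.

Lemma sum_pow_even (R : comNzRingType) (q : R) (k : nat) :
  \sum_(i < k.*2) q ^+ i = (1 + q) * \sum_(i < k) q ^+ i.*2.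
Proof.
elim: k => [|k IH]; first by rewrite !big_ord0 mulr0.
by rewrite doubleS !big_ord_recr /= IH mulrDr exprS; ring.
Qed.

(** The product is [q^(2h+1) [h+1]_q [h+2]_q], and [1 + q] divides the factor of even length. *)
Lemma hole_weight_dvd (R : comNzRingType) (q : R) (h : nat) :
  exists u, hole_weight q h * hole_weight q h.+1 = u * (q * (1 + q)).
Proof.
rewrite !hole_weightE; case/boolP: (odd h) => oh.
  have -> : \sum_(i < h.+1) q ^+ i = (1 + q) * \sum_(i < h.+1./2) q ^+ i.*2.
    by rewrite -sum_pow_even (_ : (h.+1./2).*2 = h.+1) //; lia.
  set a := \sum_(i < _) _; set b := \sum_(i < _) _.
  by exists (q ^+ h * a * (q ^+ h * b)); rewrite exprS; ring.
have -> : \sum_(i < h.+2) q ^+ i = (1 + q) * \sum_(i < h.+2./2) q ^+ i.*2.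
  by rewrite -sum_pow_even (_ : (h.+2./2).*2 = h.+2) //; lia.
set a := \sum_(i < _) _; set b := \sum_(i < _) _.
by exists (q ^+ h * a * (q ^+ h * b)); rewrite exprS; ring.
Qed.

(** With [y = 1] the variable [t] comes from up steps only, and each of these also brings a factor
    [d]. *)
Lemma motzkin_coef_dvd (R : comNzRingType) (q d : R) (m z k : nat) :
  (forall h, exists u, hole_weight q h * hole_weight q h.+1 = u * d) ->
  exists e, (motzkin q%:P 'X 1 m z)`_k = e * d ^+ k.
Proof.
move=> dvd; elim: m z k => [|m IH] [|z] k /=.
- by exists (k == 0%N)%:R; rewrite coef1; case: k => [|k]; rewrite ?mulr1 ?mul0r.
- by exists 0; rewrite coef0 mul0r.
- by exists 0; rewrite coef0 mul0r.
have hwE h : hole_weight q%:P h = (hole_weight q h)%:P.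
  by rewrite /hole_weight rmorph_sum; apply: eq_bigr => i _; rewrite -polyC_exp.
have [e1 E1] := IH z k; have [e2 E2] := IH z.+1 k; have [u U] := dvd z.
rewrite !hwE -polyCM U mul1r !coefD coefCM E1 E2 -mulrA coefXM.
case: k E1 E2 => [|k] E1 E2 /=.
  by exists (e1 + hole_weight q z * e2); ring.
have [e0 E0] := IH z.+2 k; rewrite coefCM E0.
by exists (u * e0 + e1 + hole_weight q z * e2); rewrite exprS; ring.
Qed.

End Divisibility.

Local Open Scope ring_scope.

(* The identity lives in Z[q][t] = {poly {poly int}}, with t = 'X, q = 'X%:P. *)
Theorem theorem1 (n : nat) (n_ge1 : (1 <= n)%N) :
  (\sum_(s : 'S_n) 'X^(exc_stat s) * ('X%:P) ^+ (inv_stat s - exc_stat s)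
     = \sum_(0 <= k < ((n - 1) %/ 2).+1)
         (gamma n k)%:P * 'X^k * (1 + 'X) ^+ (n - 1 - 2 * k)
     :> {poly {poly int}})
  /\ (forall k : nat, (k <= (n - 1) %/ 2)%N ->
        exists d : {poly int}, gamma n k = d * ('X^k * (1 + 'X) ^+ k)).
Proof.
split=> [|k _].
  rewrite (sum_exc_motzkin _ _ n_ge1) -gamma_sum // big_mkord subn1.
  (* Group by the number of descents, which [des_le] keeps within the range of [inord]. *)
  rewrite (partition_big (fun s => inord (des_stat s) : 'I_(n.-1 %/ 2).+1) predT) //=.
  apply: eq_bigr => k _; rewrite /gamma rmorph_sum !mulr_suml.
  have desE (s : 'S_n) : dd0_stat s == 0%N ->
      (inord (des_stat s) == k) = (des_stat s == k).
    by move/des_le => le_n; rewrite -val_eqE /= inordK //; lia.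
  apply: eq_big => [s|s /andP[dd]].
    by rewrite inE andbC; apply: andb_id2r => /desE.
  by rewrite desE // => /eqP->; rewrite rmorphXn.
(* By [gamma_sum] at [y = 1], the coefficient of [t^k] is exactly [gamma n k]. *)
have [e E] := motzkin_coef_dvd n 1 k (hole_weight_dvd ('X : {poly int})).
exists e; rewrite -exprMn -E -gamma_sum // coef_sum /gamma [LHS]big_mkcond [RHS]big_mkcond.
apply: eq_bigr => s _; rewrite inE; case: (dd0_stat s == 0%N); rewrite ?andbF // andbT.
rewrite expr1n mulr1 -polyC_exp coefCM coefXn [k == _]eq_sym.
by case: (_ == k); rewrite ?mulr1 ?mulr0.
Qed.
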